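(* Let $E>4$ be an even integer and let $P_1$ be an odd prime with $P_1 < E/2$. Let $A$ be the smallest primorial greater than $E$. If $E \bmod p \neq P_1 \bmod p$ for every seed prime $p$ of $A$ (i.e. every prime $p\le\sqrt{A}$), then $P_2 = E - P_1$ is a prime number, and $P_1$ and $P_2$ form a Goldbach solution for $E$.
   Context: A primorial is a product $P\# = 2\cdot 3\cdot 5\cdots P$ of all primes up to some prime $P$. The seed primes of a primorial $A$ are the primes $\le\sqrt{A}$. For an integer $x$ and prime $p$, $x \bmod p$ denotes the residue of $x$ in $\{0,1,\dots,p-1\}$. A Goldbach solution for an even integer $E$ is a pair of odd primes $P_1,P_2$ with $P_1+P_2=E$. *)

(* Defs.v *)
From mathcomp Require Import all_boot all_order all_algebra all_field.
Set Implicit Arguments.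
Unset Strict Implicit.
Unset Printing Implicit Defensive.
Import Num.Theory.

Definition primorial (P : nat) : nat := \prod_(0 <= p < P.+1 | prime p) p.

Definition is_primorial (A : nat) : Prop :=
  exists2 P : nat, prime P & A = primorial P.

Definition smallest_primorial_above (E A : nat) : Prop :=
  [/\ is_primorial A, E < A &
      forall B : nat, is_primorial B -> E < B -> A <= B].

(* The square root is the exact one, taken in the algebraic numbers: for the
   nonnegative real A%:R, sqrtC is its usual nonnegative real square root. *)
Definition seed_prime (A p : nat) : bool :=
  prime p && (p%:R <= sqrtC (A%:R : algC))%R.

Definition goldbach_solution (E P1 P2 : nat) : Prop :=
  [/\ prime P1 && odd P1, prime P2 && odd P2 & P1 + P2 = E].

(* Main.v *)
Require Import Defs.
From mathcomp Require Import all_boot all_order all_algebra all_field.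
Import Num.Theory.

(** If [E - P1] were composite, its least prime factor [p] would satisfy [p ^ 2 <= E - P1 <= E < A],
    so [p] would be a seed prime. But [p] divides [E - P1], so [E] and [P1] agree modulo [p],
    against the residue hypothesis. *)

Lemma seed_prime_sqr (A p : nat) : seed_prime A p = prime p && (p ^ 2 <= A).
Proof.
(* Writing [p] as [sqrtC (p ^ 2)] lets monotonicity of the root move the comparison back to
   [nat]. *)
by rewrite /seed_prime -{1}[p%:R%R]sqrCK ?ler0n // ler_sqrtC ?qualifE /=
           ?exprn_ge0 ?ler0n // -GRing.natrX ler_nat.
Qed.

Theorem theorem8 (E P1 A : nat)
    (E_gt4 : 4 < E) (E_even : ~~ odd E)
    (P1_prime : prime P1) (P1_odd : odd P1) (P1_lt : P1 < E./2)
    (A_smallest : smallest_primorial_above E A)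
    (residues : forall p : nat, seed_prime A p -> E %% p <> P1 %% p) :
  prime (E - P1) /\ goldbach_solution E P1 (E - P1).
Proof.
have [_ E_lt_A _] := A_smallest.
have half_le : E./2 <= E by rewrite -{2}(odd_double_half E) -addnn addnA leq_addl.
have P1_le : P1 <= E := ltnW (leq_trans P1_lt half_le).
have P2_gt1 : 1 < E - P1.
  have P1_gt1 := prime_gt1 P1_prime.
  rewrite ltn_subRL -(odd_double_half E) (negbTE E_even) add0n -addnn.
  by rewrite -addSn leq_add // ltnW // (ltn_trans P1_gt1).
have P2_prime : prime (E - P1).
  apply: ltn_pdiv2_prime; first exact: ltnW.
  rewrite ltnNge; apply/negP => pdiv_le.
  (* The least prime factor is the seed prime at which the residues collide. *)
  apply: (residues (pdiv (E - P1))).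
    rewrite seed_prime_sqr pdiv_prime //=.
    by rewrite (leq_trans pdiv_le) // (leq_trans (leq_subr _ _)) // ltnW.
  by apply/eqP; rewrite eqn_mod_dvd // pdiv_dvd.
split=> //; split; last exact: subnKC.
  by rewrite P1_prime.
(* Even minus odd is odd, which excludes [P2 = 2]. *)
by rewrite P2_prime oddB // (negbTE E_even) P1_odd.
Qed.
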